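(* For every instance of ROLDARP, if $\mathrm{rev}(\mathrm{OPT}(t_f))+\mathrm{rev}(\mathrm{OPT}(t_{f-1}))\le c$ for a constant $c$, then $$\sum_{j=1}^f \mathrm{rev}(\mathrm{OPT}(t_j))\le 5\sum_{j=1}^f \mathrm{rev}(\mathrm{SBP}(t_j))+c.$$
   Context: ROLDARP: an instance consists of a complete undirected graph $G=(V,E)$ with positive edge weights $w(u,v)$ (travel times), an origin $o\in V$, a time limit $T>0$, an integer $f$ with $1<f<T$ such that every edge weight is at most $T/f$, and a sequence of requests $(s,d,t,p)$ (source, destination, release time $t\ge0$, revenue $p>0$). A unit-capacity server starts at $o$ at time $0$; serving a request means travelling to $s$ and then from $s$ to $d$, starting from $s$ no earlier than $t$; at most one request is carried at a time, service is non-preemptive, and revenue $p$ is earned if the request is completed by time $T$. Requests become known to an online algorithm at their release times. $\mathrm{OPT}$ is an optimal offline schedule (knowing all requests in advance) maximizing total revenue. Time is split into $f$ segments $t_1,\dots,t_f$ of length $T/f$, where $t_j$ ends at time $jT/f$; $\mathrm{rev}(\mathrm{ALG}(t_j))$ denotes the total revenue of the requests that schedule $\mathrm{ALG}$ completes during segment $t_j$. Algorithm SBP (Segmented Best Path): if $f$ is odd, it stays idle during $t_1$ and sets $i=2$; otherwise $i=1$. While $i<f$: at the start of segment $t_i$ it computes a max-revenue-request-set $R$, namely, among requests released by that time and not yet served, a sequence of requests $r_1,\dots,r_\ell$ that can be served consecutively (serve $r_1$, travel from the destination of $r_1$ to the source of $r_2$, serve $r_2$, etc.) starting at the source of $r_1$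 within total time at most $T/f$, of maximum total revenue. If $R$ is non-empty it moves to the source of $r_1$ during $t_i$ and serves $R$ during $t_{i+1}$; otherwise it stays idle during $t_i$ and $t_{i+1}$. Then $i$ is increased by $2$. *)

(* Defs.v *)
From mathcomp Require Import all_boot all_order all_algebra.
Set Implicit Arguments. Unset Strict Implicit. Unset Printing Implicit Defensive.
Import Order.TTheory GRing.Theory Num.Theory.
Local Open Scope ring_scope.

Record request (R : realFieldType) (V : finType) := Request {
  source : V;
  dest : V;
  release : R;
  revenue : R;
  release_ge0 : 0 <= release;
  revenue_gt0 : 0 < revenue }.

(* The graph is complete and has no loops, so [weight u v] is only meaningful
   when [u != v]. Requests are identified by their position in the input
   sequence: two requests may carry the same data. *)
Record roldarp (R : realFieldType) (V : finType) := Roldarp {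
  weight : V -> V -> R;
  origin : V;
  horizon : R;
  nseg : nat;
  nreq : nat;
  req : 'I_nreq -> request R V;
  weight_sym : forall u v, u != v -> weight u v = weight v u;
  weight_gt0 : forall u v, u != v -> 0 < weight u v;
  horizon_gt0 : 0 < horizon;
  nseg_gt1 : (1 < nseg)%N;
  nseg_lt_horizon : nseg%:R < horizon;
  weight_le : forall u v, u != v -> weight u v <= horizon / nseg%:R }.

Section Model.

Context {R : realFieldType} {V : finType}.
Variable I : roldarp R V.

Local Notation T := (horizon I).
Local Notation f := (nseg I).
Local Notation idx := 'I_(nreq I).

Definition src (r : idx) : V := source (req r).
Definition dst (r : idx) : V := dest (req r).
Definition reltime (r : idx) : R := release (req r).
Definition price (r : idx) : R := revenue (req r).

Fixpoint walk_length (u : V) (p : seq V) : R :=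
  if p is v :: p' then weight I u v + walk_length v p' else 0.

(* The server can go from u to v within time tau. The triangle inequality is
   not assumed, so it may use any walk of the graph; the empty walk is allowed
   when u = v. *)
Definition can_travel (u v : V) (tau : R) : Prop :=
  exists p : seq V,
    [/\ path (fun x y => x != y) u p, last u p = v & walk_length u p <= tau].

Record service := Service {
  served : idx;
  start : R;    (* departure from the source, carrying the request *)
  finish : R }. (* delivery at the destination *)

(* The services of S can be executed in this order by a server that is at u at
   time tau. *)
Fixpoint feasible (u : V) (tau : R) (S : seq service) : Prop :=
  if S is x :: S' then
    [/\ can_travel u (src (served x)) (start x - tau),
        reltime (served x) <= start x,
        can_travel (src (served x)) (dst (served x)) (finish x - start x)
      & feasible (dst (served x)) (finish x) S']
  else True.

Definition schedule (S : seq service) : Prop :=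
  uniq (map served S) /\ feasible (origin I) 0 S.

Definition total_revenue (S : seq service) : R :=
  \sum_(x <- S | finish x <= T) price (served x).

Definition optimal (S : seq service) : Prop :=
  schedule S /\
  forall S', schedule S' -> total_revenue S' <= total_revenue S.

Definition seg_end (j : nat) : R := j%:R * (T / f%:R).

(* The j-th segment, for 1 <= j <= f, is ](j-1)T/f, jT/f], except that the
   first one also contains time 0: the f segments partition [0, T]. *)
Definition in_segment (j : nat) (tau : R) : bool :=
  (if j == 1%N then 0 <= tau else seg_end j.-1 < tau) && (tau <= seg_end j).

Definition seg_revenue (S : seq service) (j : nat) : R :=
  \sum_(x <- S | in_segment j (finish x)) price (served x).

(* Starting at u, the requests of L can be served consecutively, in this order,
   within total time tau (release times are ignored). *)
Fixpoint can_serve (u : V) (L : seq idx) (tau : R) : Prop :=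
  if L is r :: L' then
    exists a b : R,
      [/\ can_travel u (src r) a, can_travel (src r) (dst r) b
        & can_serve (dst r) L' (tau - a - b)]
  else 0 <= tau.

Definition candidate (tau : R) (done : seq idx) (L : seq idx) : Prop :=
  [/\ uniq L,
      forall r, r \in L -> reltime r <= tau /\ r \notin done
    & if L is r :: _ then can_serve (src r) L (T / f%:R) else True].

Definition max_revenue_request_set (tau : R) (done : seq idx) (L : seq idx)
    : Prop :=
  candidate tau done L /\
  forall L', candidate tau done L' ->
    \sum_(r <- L') price r <= \sum_(r <- L) price r.

(* [sbp_state i u S]: in some execution of the algorithm, the main loop is
   entered with loop index i at the start of segment i, the server being at u
   and having executed S. Executions are not unique: ties between request sets
   of maximum revenue are broken arbitrarily, and the chosen requests may be
   served with any feasible timing within segment i+1. *)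
Inductive sbp_state : nat -> V -> seq service -> Prop :=
| SbpInit :
    sbp_state (if odd f then 2%N else 1%N) (origin I) [::]
| SbpIdle i u S :
    sbp_state i u S -> (i < f)%N ->
    max_revenue_request_set (seg_end i.-1) (map served S) [::] ->
    sbp_state i.+2 u S
| SbpServe i u S r L B :
    sbp_state i u S -> (i < f)%N ->
    max_revenue_request_set (seg_end i.-1) (map served S) (r :: L) ->
    can_travel u (src r) (T / f%:R) ->
    map served B = r :: L ->
    feasible (src r) (seg_end i) B ->
    all (fun x => finish x <= seg_end i.+1) B ->
    sbp_state i.+2 (dst (last r L)) (S ++ B).

Definition sbp_schedule (S : seq service) : Prop :=
  exists i u, sbp_state i u S /\ (f <= i)%N.

End Model.

(* Main.v *)
Require Import Defs.
From mathcomp Require Import all_boot all_order all_algebra.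
From mathcomp Require Import lra zify.
Import Order.TTheory GRing.Theory Num.Theory.
Local Open Scope ring_scope.

(** The requests that OPT completes in segment [j] and that SBP never serves
    split into the first one, which may be picked up before the segment starts
    but whose edge fits in a segment, and the others, which are carried
    entirely within the segment.  Both parts are candidates for SBP at the start
    of every segment [i > j], so together they earn at most twice the revenue
    that SBP collects in the iteration with index [i].  Charging segments
    [i - 2] and [i - 1] to iteration [i] covers all segments up to [f - 2] and
    costs four times the revenue of SBP.  The requests that OPT shares with SBP
    cost one more time this revenue, and the last two segments are bounded by
    [c]. *)

Section SegmentedBestPath.

Set Implicit Arguments. Unset Strict Implicit.

Variables (R : realFieldType) (V : finType) (I : roldarp R V).

Local Notation seglen := (horizon I / (nseg I)%:R).

(** * Segment lengths, walks and travel times *)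

Lemma seglen_gt0 : 0 < seglen.
Proof.
by rewrite divr_gt0 ?horizon_gt0 // ltr0n (ltn_trans _ (nseg_gt1 I)).
Qed.

Lemma seg_end0 : seg_end I 0 = 0.
Proof. exact: mul0r. Qed.

Lemma seg_endS j : seg_end I j.+1 = seg_end I j + seglen.
Proof. by rewrite /seg_end -natr1 mulrDl mul1r. Qed.

Lemma seg_end_le j k : (j <= k)%N -> seg_end I j <= seg_end I k.
Proof. by move=> jk; rewrite ler_wpM2r ?ler_nat // ltW ?seglen_gt0. Qed.

Lemma price_ge0 (r : 'I_(nreq I)) : 0 <= price r.
Proof. exact/ltW/revenue_gt0. Qed.

Lemma walk_length_ge0 u p :
  path (fun x y : V => x != y) u p -> 0 <= walk_length I u p.
Proof.
elim: p u => //= v p IHp u /andP[uv pth].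
by rewrite addr_ge0 ?IHp // ltW // weight_gt0.
Qed.

Lemma walk_length_cat u p q :
  walk_length I u (p ++ q) = walk_length I u p + walk_length I (last u p) q.
Proof. by elim: p u => [|v p IHp] u /=; rewrite ?add0r // IHp addrA. Qed.

Lemma can_travel_ge0 u v t : can_travel I u v t -> 0 <= t.
Proof. by case=> p [/walk_length_ge0 ? _]; apply: le_trans. Qed.

Lemma can_travel_refl u : can_travel I u u 0.
Proof. by exists [::]. Qed.

Lemma can_travel_trans u v w s t :
  can_travel I u v s -> can_travel I v w t -> can_travel I u w (s + t).
Proof.
move=> [p [pp <- lp]] [q [pq <- lq]]; exists (p ++ q).
by rewrite cat_path pp pq last_cat walk_length_cat lerD.
Qed.

Lemma can_travel_mono u v s t :
  s <= t -> can_travel I u v s -> can_travel I u v t.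
Proof. by move=> st [p [? ? /le_trans lp]]; exists p; split=> //; apply: lp. Qed.

Lemma can_travel_seglen u v : can_travel I u v seglen.
Proof.
have [->|uv] := eqVneq u v.
  exact: can_travel_mono (ltW seglen_gt0) (can_travel_refl v).
by exists [:: v]; rewrite /= uv addr0 weight_le.
Qed.

(** * Feasible schedules and consecutive service *)

Lemma can_serve_mono u (L : seq 'I_(nreq I)) s t :
  s <= t -> can_serve u L s -> can_serve u L t.
Proof.
elim: L u s t => [|r L IHL] u s t st /=; first by move/le_trans; apply.
move=> [a [b [ua ub H]]]; exists a, b; split=> //.
by apply: IHL H; rewrite !lerB.
Qed.

Lemma can_serve_from_src u r (L : seq 'I_(nreq I)) t :
  can_serve u (r :: L) t -> can_serve (src r) (r :: L) t.
Proof.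
move=> [a [b [ua ub H]]]; exists 0, b; split=> //; first exact: can_travel_refl.
by apply: can_serve_mono H; have := can_travel_ge0 ua; lra.
Qed.

Lemma feasible_shift u v s t (S : seq (service I)) :
  can_travel I u v (t - s) -> feasible v t S -> feasible u s S.
Proof.
case: S => [|x S] //= uv [vx rx sx H]; split=> //.
by have := can_travel_trans uv vx; congr can_travel; lra.
Qed.

(** The server still drives the route of a dropped request: its two legs are joined to the approach
    of the next service. *)
Lemma feasible_filter u t (S : seq (service I)) (P : pred (service I)) :
  feasible u t S -> feasible u t (filter P S).
Proof.
elim: S u t => [|x S IHS] u t //= [ux rx xd /IHS H]; case: ifP => _ //=.
apply: feasible_shift H.
by have := can_travel_trans ux xd; congr can_travel; lra.
Qed.

Lemma feasible_timing u t (S : seq (service I)) :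
  feasible u t S -> forall x, List.In x S ->
  t <= finish x /\ reltime (served x) <= finish x.
Proof.
elim: S u t => [|x S IHS] u t //= [/can_travel_ge0 ? ? /can_travel_ge0 ? /IHS H] y.
by move=> [<-|/H[]] *; split; lra.
Qed.

(** Waiting is absorbed by the travel legs, as [can_travel] only bounds their length from above. *)
Lemma feasible_can_serve u t e (S : seq (service I)) :
    t <= e -> (forall x, List.In x S -> finish x <= e) ->
  feasible u t S -> can_serve u (map (@served _ _ I) S) (e - t).
Proof.
elim: S u t => [|x S IHS] u t te Se /=; first by rewrite subr_ge0.
move=> [ux rx xd H]; exists (start x - t), (finish x - start x); split=> //.
have -> : e - t - (start x - t) - (finish x - start x) = e - finish x by lra.
by apply: IHS H => [|y yS]; apply: Se; [left|right].
Qed.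

(** * Sublists of services and revenue sums *)

Lemma In_filter (T : Type) (P : pred T) (s : seq T) x :
  List.In x (filter P s) -> P x /\ List.In x s.
Proof.
elim: s => //= y s IHs; case: ifP => Py /=; last by move/IHs => -[]; auto.
by move=> [<-|/IHs[]]; auto.
Qed.

Lemma In_map_served r (S : seq (service I)) :
  r \in map (@served _ _ I) S -> exists2 x, List.In x S & served x = r.
Proof.
elim: S => //= y S IHS; rewrite inE => /orP[/eqP->|/IHS[x xS xr]].
  by exists y; auto.
by exists x; auto.
Qed.

Lemma uniq_map_filter (T : Type) (U : eqType) (g : T -> U) (P : pred T) s :
  uniq (map g s) -> uniq (map g (filter P s)).
Proof.
elim: s => //= x s IHs /andP[xs /IHs us]; case: ifP => //= _.
rewrite us andbT; apply: contra xs.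
elim: s {IHs us} => //= y s IHs; case: ifP => _ /=; rewrite !inE.
  by case/orP => [->//|/IHs ->]; rewrite orbT.
by move/IHs ->; rewrite orbT.
Qed.

Lemma sum_price_served (S : seq (service I)) :
  \sum_(x <- S) price (served x) = \sum_(r <- map (@served _ _ I) S) price r.
Proof. by rewrite big_map. Qed.

Lemma sum_price_subset (A B : seq 'I_(nreq I)) :
  uniq A -> uniq B -> {subset A <= B} ->
  \sum_(r <- A) price r <= \sum_(r <- B) price r.
Proof.
move=> uA uB AB; rewrite !big_uniq //= [leRHS](bigID (mem A)) /=.
rewrite [X in _ <= X + _](eq_bigl (mem A)) ?lerDl ?sumr_ge0 // => [r _|r /=].
  exact: price_ge0.
by case: (boolP (r \in A)) => [/AB ->|]; rewrite ?andbF.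
Qed.

(** The factor 2 comes from two candidates: the first of the selected services alone, and all the
    later ones together. [D] stands for everything that SBP ever serves, [done] for what it has
    served so far. *)
Lemma segment_unserved_revenue u (S : seq (service I)) i j
    (done D L : seq 'I_(nreq I)) :
    uniq (map (@served _ _ I) S) -> feasible u 0 S ->
    max_revenue_request_set (seg_end I i) done L ->
    {subset done <= D} -> (0 < j <= i)%N ->
  \sum_(x <- S | in_segment I j (finish x) && (served x \notin D))
     price (served x) <= 2%:R * \sum_(r <- L) price r.
Proof.
move=> uS fS [_ maxL] doneD /andP[j0 ji].
rewrite -big_filter; set P := (fun x => _ && _); set X := filter P S.
have XP x : List.In x X -> P x by move=> xX; have [] := In_filter xX.
have: uniq (map (@served _ _ I) X) by exact: uniq_map_filter.
have fX : feasible u 0 X by exact: feasible_filter.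
have relX r : r \in map (@served _ _ I) X -> reltime r <= seg_end I i /\ r \notin done.
  (* A request is released no later than its completion, hence by time [seg_end I i]. *)
  case/In_map_served=> x xX <-; have [_ rx] := feasible_timing fX xX.
  have /andP[/andP[_ fx] xD] := XP _ xX; split; last exact: contra (doneD _) xD.
  by rewrite (le_trans rx) // (le_trans fx) // seg_end_le.
move: X XP fX relX => [|x X] XP fX relX /=.
  move=> _; rewrite big_nil mulr_ge0 ?ler0n // sumr_ge0 // => r _.
  exact: price_ge0.
case/andP=> _ uX; rewrite big_cons mulr_natl mulr2n lerD //.
  have := maxL [:: served x]; rewrite big_seq1; apply; split=> //.
    by move=> r; rewrite inE => /eqP->; apply: relX; rewrite inE eqxx.
  exists 0, seglen; split; first exact: can_travel_refl.
    exact: can_travel_seglen.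
  by rewrite /= subr0 subrr.
rewrite sum_price_served.
apply: maxL; split=> //= [r rX|]; first by apply: relX; rewrite inE rX orbT.
have fX' : feasible (dst (served x)) (finish x) X by case: fX.
(* The first service ends no earlier than segment [j] starts, so what follows it fits in one segment
   length. Segment 1 is special because it contains time 0. *)
have xe : seg_end I j.-1 <= finish x.
  have /andP[/andP[+ _] _] := XP x (or_introl erefl).
  by case: (eqVneq j 1%N) => [->|_]; rewrite ?seg_end0 // => /ltW.
have fe y : List.In y (x :: X) -> finish y <= seg_end I j.
  by case/XP/andP=> /andP[].
have /can_serve_mono serveX := feasible_can_serve (fe x (or_introl erefl))
  (fun y yX => fe y (or_intror yX)) fX'.
have {serveX} := serveX seglen; case: {uX fX' fe XP fX relX} X => //= y X.
(* A candidate starts at the source of its first request, so the trip there from [dst (served x)] is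
   dropped. *)
move=> serveX; apply: (@can_serve_from_src (dst (served x))).
apply: serveX; rewrite -(prednK j0) seg_endS; lra.
Qed.

(** * Summation over segments *)

Lemma sum_in_segment m (t a : R) :
  \sum_(1 <= j < m.+2 | in_segment I j t) a
    = if (0 <= t) && (t <= seg_end I m.+1) then a else 0.
Proof.
elim: m => [|m IHm]; first by rewrite big_mkcond big_nat1.
rewrite big_mkcond big_nat_recr //= -big_mkcond IHm /in_segment /=.
rewrite [seg_end I m.+2]seg_endS; have := seglen_gt0.
have : 0 <= seg_end I m.+1 by rewrite -seg_end0 seg_end_le.
(* Whether [t] is negative, in an earlier segment, in the last one or beyond it, at most one segment
   contains it. *)
case: (lerP 0 t) => ? ? ?; case: (lerP t (seg_end I m.+1)) => ? /=;
  case: (lerP t (seg_end I m.+1 + seglen)) => ? /=; rewrite ?addr0 ?add0r //; lra.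
Qed.

Lemma sum_segments_exchange m (S : seq (service I)) (P : pred (service I)) :
  \sum_(1 <= j < m) \sum_(x <- S | in_segment I j (finish x) && P x)
     price (served x)
  = \sum_(x <- S | P x) \sum_(1 <= j < m | in_segment I j (finish x))
      price (served x).
Proof.
rewrite (exchange_big_dep P) /= => [|j x _ /andP[] //].
by apply: eq_bigr => x Px; apply: eq_bigl => j; rewrite Px andbT.
Qed.

Lemma sum_segments_le m (S : seq (service I)) (P : pred (service I)) :
  \sum_(1 <= j < m) \sum_(x <- S | in_segment I j (finish x) && P x)
     price (served x) <= \sum_(x <- S | P x) price (served x).
Proof.
rewrite sum_segments_exchange ler_sum // => x _.
(* For [m <= 1] the range is empty, a case outside [sum_in_segment]. *)
case: m => [|[|m]]; try by rewrite big_geq // price_ge0.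
by rewrite sum_in_segment; case: ifP => // _; apply: price_ge0.
Qed.

Lemma sum_seg_revenue (S : seq (service I)) :
    (forall x, List.In x S -> 0 <= finish x <= seg_end I (nseg I)) ->
  \sum_(1 <= j < (nseg I).+1) seg_revenue S j
    = \sum_(x <- S) price (served x).
Proof.
move=> HS; rewrite /seg_revenue.
under eq_bigr do under eq_bigl do rewrite -[in_segment _ _ _]andbT.
rewrite (sum_segments_exchange _ _ xpredT).
have := nseg_gt1 I; case: (nseg I) HS => [|[|f]] // HS _.
elim: S HS => [|x S IHS] HS; rewrite ?big_nil //.
rewrite [LHS]big_cons [RHS]big_cons.
rewrite sum_in_segment HS /=; last by left.
by rewrite IHS // => y yS; apply: HS; right.
Qed.

(** * Charging the unserved revenue of OPT to the iterations of SBP *)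

Section Invariant.

Variables (u0 : V) (OPT : seq (service I)).
Hypotheses (uOPT : uniq (map (@served _ _ I) OPT)) (fOPT : feasible u0 0 OPT).

Definition unserved_revenue (D : seq 'I_(nreq I)) (j : nat) : R :=
  \sum_(x <- OPT | in_segment I j (finish x) && (served x \notin D))
     price (served x).

Lemma unserved_revenue_step i (done D L : seq 'I_(nreq I)) (a : R) :
    max_revenue_request_set (seg_end I i.-1) done L ->
    {subset done <= D} -> (0 < i)%N ->
    \sum_(1 <= j < i - 2) unserved_revenue D j <= a ->
  \sum_(1 <= j < i) unserved_revenue D j
    <= a + 4%:R * \sum_(r <- L) price r.
Proof.
move=> maxL doneD i0.
have bound j : (0 < j < i)%N ->
    unserved_revenue D j <= 2%:R * \sum_(r <- L) price r.
  by move=> ji; apply: (segment_unserved_revenue uOPT fOPT maxL doneD); lia.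
have L0 : 0 <= \sum_(r <- L) price r by apply: sumr_ge0 => r _; apply: price_ge0.
(* Going from [i - 2] to [i] adds no segment if [i = 1], one if [i = 2] and two otherwise, each
   worth at most twice the revenue of [L]. *)
case: i i0 maxL bound => [|[|[|i]]] // _ _ bound.
- by rewrite !big_geq //; lra.
- by rewrite big_nat1 big_geq //; have := bound 1%N isT; lra.
- rewrite subn2 /= => H; rewrite 2?big_nat_recr //=.
  by have := bound i.+1; have := bound i.+2; rewrite !ltnS leqnn leqnSn /=; lra.
Qed.

(** Parity fixes the index at which the loop stops. Quantifying over all supersets [D] keeps the
    bound usable while [S] grows, so that [D] can finally be everything SBP serves. *)
Lemma sbp_state_invariant i u S : sbp_state (I := I) i u S ->
  [/\ (0 < i <= (nseg I).+1)%N /\ odd i = ~~ odd (nseg I),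
      uniq (map (@served _ _ I) S),
      forall x, List.In x S -> 0 <= finish x <= seg_end I (nseg I)
    & forall D, {subset map (@served _ _ I) S <= D} ->
        \sum_(1 <= j < i - 2) unserved_revenue D j
          <= 4%:R * \sum_(x <- S) price (served x)].
Proof.
elim=> {i u S} [|i u S _ [[i0 oi] uS tS H] ltif maxL
               |i u S r L B _ [[i0 oi] uS tS H] ltif maxL _ sB fB eB].
- have := nseg_gt1 I => f1; split=> //; first by case: odd; split=> //; lia.
  by move=> D _; rewrite big_nil mulr0 big_geq //; case: ifP.
- split=> //; first by split; [lia|rewrite /= negbK].
  (* The chosen set is empty and of maximum revenue, so the added segments contribute nothing. *)
  move=> D SD; have := unserved_revenue_step maxL SD _ (H _ SD).
  by rewrite big_nil mulr0 addr0 subn2 /=; apply; case/andP: i0.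
- have [[uL relL _] _] := maxL; split.
  + by split; [lia|rewrite /= negbK].
  + rewrite map_cat sB cat_uniq uS uL andbT.
    by apply/hasPn => q /relL[].
  (* Services of [B] finish between [seg_end I i] and [seg_end I i.+1], and [i < nseg I]. *)
  + move=> x /List.in_app_iff[/tS //|xB].
    have [+ _] := feasible_timing fB xB.
    have : finish x <= seg_end I i.+1.
      elim: B xB eB {sB fB} => //= y B IHB [->|/IHB h] /andP[//].
    have : seg_end I i.+1 <= seg_end I (nseg I) by exact: seg_end_le.
    by have : 0 <= seg_end I i by [rewrite -seg_end0 seg_end_le]; lra.
  + move=> D SD; rewrite subn2 /= big_cat mulrDr /=.
    rewrite (sum_price_served B) sB.
    have SD' : {subset map (@served _ _ I) S <= D}.
      by move=> q qS; apply: SD; rewrite map_cat mem_cat qS.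
    by apply: unserved_revenue_step maxL SD' _ (H _ SD'); case/andP: i0.
Qed.

End Invariant.

End SegmentedBestPath.

Theorem theorem3 (R : realFieldType) (V : finType) (I : roldarp R V)
    (OPT SBP : seq (service I)) (c : R)
    (hOPT : optimal OPT) (hSBP : sbp_schedule SBP)
    (hc : seg_revenue OPT (nseg I) + seg_revenue OPT (nseg I).-1 <= c) :
  \sum_(1 <= j < (nseg I).+1) seg_revenue OPT j
    <= 5%:R * (\sum_(1 <= j < (nseg I).+1) seg_revenue SBP j) + c.
Proof.
have [[uOPT fOPT] _] := hOPT.
have [i [u [/(sbp_state_invariant uOPT fOPT)[[i_le oi] uS tS H] fi]]] := hSBP.
(* The index is [nseg I] or its successor, and parity excludes the former. *)
have {fi i_le oi} i_eq : i = (nseg I).+1.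
  case: (eqVneq i (nseg I)) => [e|]; last by lia.
  by move: oi; rewrite e; case: odd.
(* With [D] the requests of SBP itself, the bound covers the segments up to [nseg I - 2]. *)
have {H} := H _ (fun r h => h); rewrite i_eq subn2 /=.
rewrite (sum_seg_revenue tS) => unserved.
set D := map (@served _ _ I) SBP in uS unserved.
(* OPT serves each request at most once, so the requests it shares with SBP earn at most the total
   of SBP. *)
have shared m : \sum_(1 <= j < m)
    \sum_(x <- OPT | in_segment I j (finish x) && (served x \in D))
      price (served x) <= \sum_(x <- SBP) price (served x).
  apply: le_trans (sum_segments_le _ _ _) _.
  rewrite -big_filter !sum_price_served.
  apply: sum_price_subset => // [|r rX]; first exact: uniq_map_filter.
  by have [x xX <-] := In_map_served rX; have [] := In_filter xX.
have := shared (nseg I).-1.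
have split_seg j : seg_revenue OPT j =
    \sum_(x <- OPT | in_segment I j (finish x) && (served x \in D))
      price (served x) + unserved_revenue OPT D j.
  by rewrite /seg_revenue (bigID (fun x => served x \in D)).
have split_last : \sum_(1 <= j < (nseg I).+1) seg_revenue OPT j =
    \sum_(1 <= j < (nseg I).-1) seg_revenue OPT j +
      (seg_revenue OPT (nseg I) + seg_revenue OPT (nseg I).-1).
  have := nseg_gt1 I; case: (nseg I) => [|[|f]] // _.
  rewrite big_nat_recr // big_nat_recr //= -addrA.
  by congr (_ + _); rewrite addrC.
rewrite split_last (eq_bigr _ (fun j _ => split_seg j)) big_split /=; lra.
Qed.
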